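(* Suppose the Uniqueness Conjecture holds, i.e. every Markov number is the maximum element in exactly one Markov triple (up to reordering the entries of the triple). Then Markov's equation $x^2+y^2+z^2=3xyz$ is not partition regular over $\mathbb{N}$.
   Context: $\mathbb{N}$ denotes the set of positive integers. A Markov triple is a triple of positive integers $(x,y,z)$ satisfying $x^2+y^2+z^2=3xyz$. A Markov number is a positive integer appearing in some Markov triple. For the purpose of the uniqueness statement, triples that differ only by a permutation of their entries are identified. A Diophantine equation $f(x_1,\dots,x_n)=0$ is partition regular over $\mathbb{N}$ if, for any finite partition $\mathbb{N}=\bigcup_{i=1}^m A_i$, there exists a cell $A_i$ that contains infinitely many solutions to the equation, i.e. there are infinitely many $(x_1,\dots,x_n)\in A_i^n$ with $f(x_1,\dots,x_n)=0$. *)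

(* Defs.v *)
From mathcomp Require Import all_boot all_order all_algebra.
From mathcomp Require Import boolp classical_sets functions cardinality.
From mathcomp Require Import mpoly.

Set Implicit Arguments.
Unset Strict Implicit.
Unset Printing Implicit Defensive.

Local Open Scope classical_set_scope.

(* Natural numbers start at 0 here, so the set of positive integers is
   spelled [set k : nat | 0 < k]. *)

Definition markov_triple (x y z : nat) : Prop :=
  [/\ 0 < x, 0 < y, 0 < z & x ^ 2 + y ^ 2 + z ^ 2 = 3 * x * y * z]%N.

Definition markov_number (m : nat) : Prop :=
  exists x y z : nat, markov_triple x y z /\ m \in [:: x; y; z].

Definition uniqueness_conjecture : Prop :=
  forall m : nat, markov_number m ->
    exists x y z : nat,
      [/\ markov_triple x y z,
          maxn x (maxn y z) = m
        & forall x' y' z' : nat,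
            markov_triple x' y' z' -> maxn x' (maxn y' z') = m ->
            perm_eq [:: x'; y'; z'] [:: x; y; z]].

Definition solutions_in (n : nat) (f : {mpoly int[n]}) (B : set nat) :
    set (n.-tuple nat) :=
  [set x | (forall i, B (tnth x i)) /\
           f.@[fun i => Posz (tnth x i)]%R = 0%R].

Definition partition_regular (n : nat) (f : {mpoly int[n]}) : Prop :=
  forall (m : nat) (A : 'I_m -> set nat),
    partition [set: 'I_m] A [set k : nat | (0 < k)%N] ->
    exists i : 'I_m, infinite_set (solutions_in f (A i)).

Definition markov_poly : {mpoly int[3]} :=
  let x : {mpoly int[3]} := 'X_(inord 0) in
  let y : {mpoly int[3]} := 'X_(inord 1) in
  let z : {mpoly int[3]} := 'X_(inord 2) in
  (x ^+ 2 + y ^+ 2 + z ^+ 2 - 3%:R * x * y * z)%R.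

(* Main.v *)
From mathcomp Require Import all_boot all_order all_algebra.
From mathcomp Require Import boolp classical_sets cardinality.
From mathcomp Require Import mpoly zify.
Require Import Defs.

(** Under uniqueness, every Markov number [m > 1] determines the triple of which
    it is the maximum, hence the minimum [p m < m] of that triple. Colouring
    [m] by the parity of the number of steps in [m, p m, p (p m), ...] gives
    [m] and [p m] different colours, so the only monochromatic triple is
    [(1, 1, 1)]. *)

Set Implicit Arguments.
Unset Strict Implicit.
Unset Printing Implicit Defensive.

Import GRing.Theory.

Local Open Scope classical_set_scope.

Section ParityColouring.
Variable p : nat -> nat.

(* [n] is fuel; any [n > m] gives the same value. *)
Fixpoint descent_parity (n m : nat) : bool :=
  if n is n'.+1 then (p m < m) && ~~ descent_parity n' (p m) else false.

Lemma descent_parity_stable n1 n2 m :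
  m < n1 -> m < n2 -> descent_parity n1 m = descent_parity n2 m.
Proof.
elim: n1 n2 m => // n1 IH [|n2] m //= lt1 lt2.
by case: ltnP => //= ltp; rewrite (IH n2) //; lia.
Qed.

Lemma descent_colouring :
  exists c : nat -> bool, forall m, p m < m -> c (p m) != c m.
Proof.
exists (fun m => descent_parity m.+1 m) => m ltp.
(* One unfolding of the fuel [m.+1] at [m] leaves fuel [m] at [p m], so both colours are compared
   with that fuel. *)
rewrite (@descent_parity_stable _ m (p m)) //= ltp.
by case: (descent_parity _ _).
Qed.

End ParityColouring.

(** With all entries equal to [x] the equation reads [3 x^2 = 3 x^3]. *)
Lemma markov_triple_min_eq_max x y z : markov_triple x y z ->
  maxn x (maxn y z) <= minn x (minn y z) -> [/\ x = 1, y = 1 & z = 1].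
Proof.
move=> [x0 y0 z0 eq] le.
have [yx zx] : y = x /\ z = x by lia.
by subst y z; have -> : x = 1 by nia.
Qed.

(** Uniqueness makes the minimum of a triple a function of its maximum; the two differ as soon as
    the maximum exceeds 1. *)
Lemma markov_parent : uniqueness_conjecture ->
  exists p : nat -> nat, forall x y z, markov_triple x y z ->
    1 < maxn x (maxn y z) ->
    p (maxn x (maxn y z)) \in [:: x; y; z] /\
    p (maxn x (maxn y z)) < maxn x (maxn y z).
Proof.
move=> uniq.
have /choice[p pP] : forall m, exists a, forall x y z, markov_triple x y z ->
    maxn x (maxn y z) = m -> 1 < m -> a \in [:: x; y; z] /\ a < m.
  move=> m; have [mm|nmm] := pselect (markov_number m); last first.
    (* No triple has maximum [m], so 0 is an arbitrary value. *)
    exists 0 => x y z t max_eq; case: nmm; exists x, y, z; split=> //.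
    by rewrite !inE -max_eq; lia.
  have [x [y [z [t max_eq only]]]] := uniq _ mm.
  exists (minn x (minn y z)) => x' y' z' t' max_eq' m1.
  rewrite (perm_mem (only _ _ _ t' max_eq')) !inE; split; first by lia.
  rewrite ltnNge -max_eq; apply/negP => /(markov_triple_min_eq_max t)[? ? ?].
  lia.
by exists p => x y z t m1; apply: pP.
Qed.

Lemma markov_colouring : uniqueness_conjecture ->
  exists c : nat -> bool, forall x y z, markov_triple x y z ->
    c x = c y -> c y = c z -> [/\ x = 1, y = 1 & z = 1].
Proof.
move=> /markov_parent[p pP]; have [c cP] := descent_colouring p.
exists c => x y z t cxy cyz; have [x0 y0 z0 _] := t.
have [m1|m1] := leqP (maxn x (maxn y z)) 1; first by split; lia.
have [p_in /cP] := pP _ _ _ t m1.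
have cE k : k \in [:: x; y; z] -> c k = c z.
  by rewrite !inE => /or3P[] /eqP -> //; rewrite cxy.
by rewrite !cE ?eqxx // !inE; lia.
Qed.

Lemma markov_polyE (t : 3.-tuple nat) :
  markov_poly.@[fun i => Posz (tnth t i)]%R = 0%R ->
  let x := tnth t (inord 0) in
  let y := tnth t (inord 1) in
  let z := tnth t (inord 2) in
  (x ^ 2 + y ^ 2 + z ^ 2 = 3 * x * y * z)%N.
Proof.
rewrite /markov_poly !(mevalB, mevalD, mevalM, rmorphXn, rmorph_nat) /=.
rewrite !mevalXU !meval1; lia.
Qed.

Theorem proposition1p5 (uniqueness : uniqueness_conjecture) :
  ~ partition_regular markov_poly.
Proof.
have [c cP] := markov_colouring uniqueness.
pose A (i : 'I_2) := [set k : nat | (0 < k)%N /\ c k = (i == ord0)].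
(* The cells of a partition must be nonempty. Both colours occur on 1 and 2, because the Markov
   triple [(1, 1, 2)] is not monochromatic. *)
have c12 : c 1 != c 2.
  apply/eqP => c12; have [] // : [/\ 1 = 1, 1 = 1 & 2 = 1].
  by apply: cP.
case/(_ 2 A).
  split.
  - apply/seteqP; split=> [k [i _ []] //|k k0].
    by exists (if c k then ord0 else ord_max) => //; split=> //; case: (c k).
  - move=> i j _ _ [k [[_ ci] [_ cj]]]; apply/val_inj.
    move: ci cj => ->; case: i j => [[|[|i]] ?] [[|[|j]] ?] //.
  - move=> i _; have [ci|ci] := eqVneq (c 1) (i == ord0); first by exists 1.
    by exists 2; split=> //; case: (c 1) (c 2) (i == ord0) c12 ci => [] [] [].
(* Each cell contains at most the solution [(1, 1, 1)]. *)
move=> i; apply; apply: (@sub_finite_set _ _ [set [tuple 1; 1; 1]]) => //.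
move=> t [tA /markov_polyE eq].
have [x0 cx] := tA (inord 0); have [y0 cy] := tA (inord 1).
have [z0 cz] := tA (inord 2).
have [] := cP _ _ _ (And4 x0 y0 z0 eq); rewrite ?cx ?cy ?cz // => x1 y1 z1.
apply: eq_from_tnth => j; rewrite -[j]inord_val.
by case: j => [[|[|[|j]]] ?] //=; rewrite ?x1 ?y1 ?z1 (tnth_nth 0) /= inordK.
Qed.
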